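(* Let $n>d\geq 1$ be integers. There are positive constants $C_3, C_4$ depending only on $d$ such that the following holds. If $f\colon\{-1,1\}^n\to\{-1,1\}$ satisfies, for some $\alpha\in(0,C_3)$, $$\mathrm{Inf}_I(f)\leq \alpha\left(\frac{\ln n}{n}\right)^{d+1}\quad\text{for all } I\subseteq[n] \text{ with } |I|=d+1,$$ then there exists $g\colon\{-1,1\}^n\to\{-1,1\}$ of degree at most $d$ such that $$|\hat f(J)-\hat g(J)|\leq C_4\,\alpha\left(\frac{\ln n}{n}\right)^{|J|}$$ for every $J\subseteq[n]$ with $|J|\leq d$.
   Context: $[n]=\{1,\dots,n\}$. For $J \subseteq [n]$ let $\chi_J(x) = \prod_{j\in J} x_j$ (with $\chi_\varnothing = 1$); every $f\colon\{-1,1\}^n\to\mathbb{R}$ has a unique expansion $f=\sum_{J\subseteq [n]} \hat f(J)\chi_J$, where $\hat f(J) = \mathbb{E}[f\chi_J]$ under the uniform measure on $\{-1,1\}^n$. The T-influence is $\mathrm{Inf}_I(f)=\sum_{J\supseteq I}\hat f(J)^2$ (sum over $J\subseteq[n]$). A function $g$ has degree at most $d$ (is ''of $d$-degree'') if $\hat g(J)=0$ for all $J$ with $|J|>d$. ''Depending only on $d$'' means the constants do not depend on $n$, $f$ or $\alpha$. *)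

(* Defs.v *)
From mathcomp Require Import all_boot all_order all_algebra.
From mathcomp Require Import reals exp.

Set Implicit Arguments.
Unset Strict Implicit.
Unset Printing Implicit Defensive.

Import Order.TTheory GRing.Theory Num.Theory.
Local Open Scope ring_scope.

(* The discrete cube {-1,1}^n.  A bit b encodes the sign (-1)^b, so the real
   coordinate x_j of a point x is [coord R x j]; the coordinates 1, ..., n are
   indexed by 'I_n. *)
Definition cube (n : nat) : finType := {ffun 'I_n -> bool}.

Definition coord (R : realType) (n : nat) (x : cube n) (j : 'I_n) : R :=
  (-1) ^+ (x j).

Definition chi (R : realType) (n : nat) (J : {set 'I_n}) (x : cube n) : R :=
  \prod_(j in J) coord R x j.

Definition expectation (R : realType) (n : nat) (f : cube n -> R) : R :=
  (\sum_(x : cube n) f x) / #|cube n|%:R.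

Definition fourier (R : realType) (n : nat) (f : cube n -> R)
    (J : {set 'I_n}) : R :=
  expectation (fun x => f x * chi R J x).

Definition T_influence (R : realType) (n : nat) (I : {set 'I_n})
    (f : cube n -> R) : R :=
  \sum_(J : {set 'I_n} | I \subset J) fourier f J ^+ 2.

Definition degree_le (R : realType) (n d : nat) (g : cube n -> R) : Prop :=
  forall J : {set 'I_n}, (d < #|J|)%N -> fourier g J = 0.

Definition sign_valued (R : realType) (n : nat) (f : cube n -> R) : Prop :=
  forall x : cube n, f x = -1 \/ f x = 1.

(* Main.v *)
Require Import Defs.
From mathcomp Require Import all_boot all_order all_algebra.
From mathcomp Require Import reals sequences exp.
From mathcomp Require Import zify ring lra.

(** Write [a J] for the Fourier coefficients of [f] and [tau] for [ln n / n]. The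
    approximation [g] is obtained by rounding every [a J] with [#|J| <= d] to the nearest
    point [b J] of the grid [2 ^- d * Z] and discarding the other coefficients; the
    errors are [e J = a J - b J].

    The weight of the high degrees is small above every [I] with [#|I| <= d]: the sum of
    [a J ^ 2] over the [J] containing [I] with [#|J| > d] is [O(alpha * tau ^ #|I|)]
    ([tail_weight_le]). Let [m = d + 1 - #|I|]. Each [J] of degree exceeding a cut of order
    [ln n] contains at least a multiple of [(ln n) ^ m] of the sets [K] of size [d + 1] above
    [I]. There are at most [n ^ m] such [K], each with influence at most
    [alpha * tau ^ (d + 1)], and [(n * tau) ^ m = (ln n) ^ m], so double counting gives the
    bound. Below the cut, the function with the coefficients of [f] above [K] has values in
    the grid [2 ^- (d + 1) * Z], so the probability that it is nonzero is controlled by its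
    second moment, which is the influence of [K]; by hypercontractivity its low-degree
    weight is then far smaller than [alpha * tau ^ (d + 1)] ([infl_low_degree]), and one
    sums over [K].

    Granularity also controls the errors ([err_le]). For [#|I| <= d] the function
    [sum_(J contains I) e J chi_J] takes values in the grid [2 ^- d * Z], where
    [|z| <= 2 ^ d * z ^ 2]. Hence [|e I|] is at most its second moment times [2 ^ d], and as
    [2 ^ d * |e I| <= 1 / 2], the term [e I ^ 2] can be absorbed: [|e I|] is at most
    [2 ^ (d + 1)] times the sum of [e J ^ 2] over the [J] strictly above [I]. The part of this
    sum with [#|J| > d] is the high-degree weight, and the part with [#|J| <= d] is small
    by descending induction on [#|I|].

    For [I] empty this bounds the expectation of [(f - g) ^ 2] by a multiple of [alpha].
    Since [f - g] is grid-valued, [g] agrees with [f] except with probability [O(alpha)],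
    so the polynomial [g ^ 2 - 1] of degree at most [2 d] is nonzero with probability
    [O(alpha)]. A polynomial of degree at most [D] which is not identically zero is nonzero
    with probability at least [9 ^- D] ([low_degree_prob_neq0]), so for small [alpha] it
    follows that [g ^ 2 = 1] everywhere. *)

Set Implicit Arguments.
Unset Strict Implicit.
Unset Printing Implicit Defensive.

Import Order.TTheory GRing.Theory Num.Theory.
Local Open Scope ring_scope.

(** * Expectation on the cube *)

Section Expectation.
Variables (R : realType) (n : nat).
Implicit Types (f g h : cube n -> R) (x y : cube n) (I J K S : {set 'I_n}).
Local Notation E := (@expectation R n).

Lemma card_cube_gt0 : 0 < #|cube n|%:R :> R.
Proof.
by rewrite ltr0n; apply/card_gt0P; exists [ffun=> false].
Qed.

Lemma expectation_ext f g : f =1 g -> E f = E g.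
Proof. by move=> fg; rewrite /expectation (eq_bigr g). Qed.

Lemma expectationD f g : E (fun x => f x + g x) = E f + E g.
Proof. by rewrite /expectation big_split mulrDl. Qed.

Lemma expectationZ (c : R) f : E (fun x => c * f x) = c * E f.
Proof. by rewrite /expectation -mulr_sumr mulrA. Qed.

Lemma expectation_sum (T : finType) (P : pred T) (F : T -> cube n -> R) :
  E (fun x => \sum_(i | P i) F i x) = \sum_(i | P i) E (F i).
Proof. by rewrite /expectation exchange_big mulr_suml. Qed.

Lemma expectation_cst (c : R) : E (fun=> c) = c.
Proof.
rewrite /expectation sumr_const -[in LHS](mulr_natr c) mulfK//.
by rewrite gt_eqF// card_cube_gt0.
Qed.

Lemma le_expectation f g : (forall x, f x <= g x) -> E f <= E g.
Proof.
by move=> fg; rewrite ler_pM2r ?invr_gt0 ?card_cube_gt0//; apply: ler_sum.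
Qed.

Lemma expectation_ge0 f : (forall x, 0 <= f x) -> 0 <= E f.
Proof. by move=> f0; rewrite -(expectation_cst 0) le_expectation. Qed.

Lemma expectation_eq0 f : (forall x, 0 <= f x) -> E f = 0 -> forall x, f x = 0.
Proof.
move=> f0 /eqP; rewrite /expectation mulf_eq0 invr_eq0 (gt_eqF card_cube_gt0).
by rewrite orbF => /eqP/psumr_eq0P fx x; apply: fx.
Qed.

Lemma ler_norm_expectation f : `|E f| <= E (fun x => `|f x|).
Proof.
by rewrite normrM normfV (ger0_norm (ltW card_cube_gt0))
  ler_pM2r ?invr_gt0 ?card_cube_gt0// ler_norm_sum.
Qed.

(** Cauchy-Schwarz, from the nonnegativity of the expected square of
    [E (g ^ 2) f - E (f g) g]. *)
Lemma expectation_cauchy_schwarz f g :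
  E (fun x => f x * g x) ^+ 2 <=
  E (fun x => f x ^+ 2) * E (fun x => g x ^+ 2).
Proof.
set a := E (fun x => f x ^+ 2); set b := E (fun x => g x ^+ 2).
set c := E (fun x => f x * g x).
have b0 : 0 <= b by apply: expectation_ge0 => x; exact: sqr_ge0.
have H : 0 <= b * (a * b - c ^+ 2).
  have -> : b * (a * b - c ^+ 2) = E (fun x => (b * f x - c * g x) ^+ 2).
    rewrite (@expectation_ext _ (fun x => b ^+ 2 * f x ^+ 2
       + (- (2 * b * c) * (f x * g x) + c ^+ 2 * g x ^+ 2))); last first.
      by move=> x; ring.
    rewrite !expectationD !expectationZ -/a -/b -/c; ring.
  by apply: expectation_ge0 => x; exact: sqr_ge0.
move: b0; rewrite le_eqVlt => /predU1P[b0|b0]; last first.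
  by move: H; rewrite pmulr_rge0// subr_ge0.
suff -> : c = 0 by rewrite -b0 mulr0 expr0n.
have g0 x : g x = 0.
  apply/eqP; rewrite -sqrf_eq0.
  by rewrite (@expectation_eq0 (fun x => g x ^+ 2)) => [//|y|]; rewrite ?sqr_ge0.
rewrite /c (@expectation_ext _ (fun=> 0)) ?expectation_cst// => x.
by rewrite g0 mulr0.
Qed.

End Expectation.

(** * Walsh polynomials and Fourier coefficients *)

Section WalshFourier.
Variables (R : realType) (n : nat).
Implicit Types (f g h : cube n -> R) (x y : cube n) (I J K S : {set 'I_n}).
Implicit Types (c : {set 'I_n} -> R).
Local Notation E := (@expectation R n).

(** The multilinear polynomial with coefficients [c]. *)
Definition walsh (c : {set 'I_n} -> R) (x : cube n) : R :=
  \sum_(J : {set 'I_n}) c J * chi R J x.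

(** The point [x] with its [i]-th coordinate negated. *)
Definition flip (i : 'I_n) (x : cube n) : cube n :=
  [ffun j => x j (+) (j == i)].

Lemma flipK i : involutive (flip i).
Proof. by move=> x; apply/ffunP => j; rewrite !ffunE addbK. Qed.

Lemma coord_flip i x j :
  Defs.coord R (flip i x) j = (if j == i then -1 else 1) * Defs.coord R x j.
Proof.
rewrite /Defs.coord ffunE signr_addb mulrC.
by case: (j == i); rewrite ?expr1 ?expr0.
Qed.

Lemma chi_flip i J x :
  chi R J (flip i x) = (if i \in J then -1 else 1) * chi R J x.
Proof.
rewrite /chi; under eq_bigr do rewrite coord_flip.
rewrite big_split/=; congr (_ * _); case: ifPn => iJ.
  rewrite (bigD1 i)//= eqxx big1 ?mulr1// => j /andP[_ /negbTE ->//].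
by rewrite big1// => j jJ; case: eqP => // ji; rewrite -ji jJ in iJ.
Qed.

Lemma expectation_flip i f : E (fun x => f (flip i x)) = E f.
Proof.
rewrite /expectation; congr (_ / _).
by rewrite [RHS](reindex_inj (inv_inj (flipK i))).
Qed.

(** A function that is odd in one coordinate has mean zero. *)
Lemma expectation_odd i f : (forall x, f (flip i x) = - f x) -> E f = 0.
Proof.
move=> fi; have := expectation_flip i f.
rewrite (@expectation_ext _ _ _ (fun x => -1 * f x)).
  by rewrite expectationZ => ?; lra.
by move=> x; rewrite fi mulN1r.
Qed.

Lemma coord_sqr x j : Defs.coord R x j * Defs.coord R x j = 1.
Proof. by rewrite /Defs.coord -expr2 sqrr_sign. Qed.

Lemma chi_if J x : chi R J x = \prod_j (if j \in J then Defs.coord R x j else 1).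
Proof. by rewrite /chi big_mkcond. Qed.

(** The symmetric difference, the product in the group of characters. *)
Definition symdiff I J := (I :\: J) :|: (J :\: I).

Lemma in_symdiff i I J : (i \in symdiff I J) = (i \in I) (+) (i \in J).
Proof. by rewrite !inE; case: (i \in I); case: (i \in J). Qed.

Lemma symdiff_eq0 I J : symdiff I J = set0 -> I = J.
Proof.
move=> /setP H; apply/setP => i; have := H i.
by rewrite in_symdiff inE; case: (i \in I); case: (i \in J).
Qed.

Lemma chiM I J x : chi R I x * chi R J x = chi R (symdiff I J) x.
Proof.
rewrite !chi_if -big_split/=; apply: eq_bigr => j _.
rewrite in_symdiff; case: (j \in I); case: (j \in J) => /=;
  by rewrite ?coord_sqr ?mulr1 ?mul1r.
Qed.

Lemma card_symdiff I J : (#|symdiff I J| <= #|I| + #|J|)%N.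
Proof.
apply: leq_trans (leq_card_setU _ _) _.
by rewrite leq_add// subset_leq_card// subsetDl.
Qed.

Lemma chi0 x : chi R set0 x = 1.
Proof. by rewrite /chi big_set0. Qed.

Lemma chi_norm J x : `|chi R J x| = 1.
Proof.
rewrite /chi normr_prod big1// => j _.
by rewrite /Defs.coord normrX normrN1 expr1n.
Qed.

Lemma expectation_chi J : E (chi R J) = (J == set0)%:R.
Proof.
case: (set_0Vmem J) => [->|[i iJ]].
  by rewrite eqxx (expectation_ext chi0) expectation_cst.
have -> : (J == set0) = false by apply/eqP => J0; rewrite J0 inE in iJ.
by apply: (@expectation_odd i) => x; rewrite chi_flip iJ mulN1r.
Qed.

Lemma expectation_chiM I J : E (fun x => chi R I x * chi R J x) = (I == J)%:R.
Proof.
rewrite (expectation_ext (chiM I J)) expectation_chi.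
suff -> : (symdiff I J == set0) = (I == J) by [].
apply/eqP/eqP => [/symdiff_eq0//|->]; apply/setP => i.
by rewrite in_symdiff addbb inE.
Qed.

Lemma expectation_walshM c c' :
  E (fun x => walsh c x * walsh c' x) = \sum_J c J * c' J.
Proof.
rewrite (@expectation_ext _ _ _ (fun x => \sum_J \sum_K
   (c J * c' K) * (chi R J x * chi R K x))); last first.
  move=> x; rewrite /walsh mulr_suml; apply: eq_bigr => J _.
  by rewrite mulr_sumr; apply: eq_bigr => K _; ring.
rewrite expectation_sum; apply: eq_bigr => J _.
rewrite expectation_sum (bigD1 J)//= big1 => [|K KJ].
  by rewrite expectationZ expectation_chiM eqxx mulr1 addr0.
by rewrite expectationZ expectation_chiM eq_sym (negbTE KJ) mulr0.
Qed.

Lemma parseval c : E (fun x => walsh c x ^+ 2) = \sum_J c J ^+ 2.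
Proof. exact: (expectation_walshM c c). Qed.

Lemma chi_walsh J x : chi R J x = walsh (fun K => (K == J)%:R) x.
Proof.
rewrite /walsh (bigD1 J)//= eqxx mul1r big1 ?addr0// => K /negbTE ->.
by rewrite mul0r.
Qed.

Lemma fourier_walsh c J : fourier (walsh c) J = c J.
Proof.
rewrite /fourier (@expectation_ext _ _ _ (fun x => walsh c x *
   walsh (fun K => (K == J)%:R) x)); last by move=> x; rewrite chi_walsh.
rewrite expectation_walshM (bigD1 J)//= eqxx mulr1 big1 ?addr0// => K /negbTE ->.
by rewrite mulr0.
Qed.

(** The kernel [\sum_J chi_J(x) chi_J(y)] is the product of the factors
    [1 + x_j y_j], hence [2 ^ n] on the diagonal and zero elsewhere. *)
Lemma sum_chi_chi x y :
  \sum_J chi R J x * chi R J y = #|cube n|%:R * (x == y)%:R.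
Proof.
have -> : \sum_J chi R J x * chi R J y =
    \prod_(j < n) (Defs.coord R x j * Defs.coord R y j + 1).
  rewrite bigA_distr/=; apply: eq_bigr => J _; rewrite !chi_if -big_split/=.
  by apply: eq_bigr => j _; case: (j \in J); rewrite ?mulr1.
have [->|xy] := eqVneq x y.
  rewrite (eq_bigr (fun=> 1 + 1)) => [|j _]; last by rewrite coord_sqr.
  by rewrite mulr1 prodr_const card_ffun card_bool card_ord natrX.
rewrite mulr0; have [j xyj] : exists j, x j != y j.
  apply/existsP; apply: contraNT xy => /existsPn xy; apply/eqP/ffunP => j.
  by have := xy j; rewrite negbK => /eqP.
rewrite (bigD1 j)//= /Defs.coord; move: xyj.
by case: (x j); case: (y j) => //= _; rewrite ?expr1 ?expr0 ?mulr1 ?mul1r addNr mul0r.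
Qed.

Lemma fourier_inversion f x : f x = walsh (fourier f) x.
Proof.
rewrite /walsh.
have -> : \sum_J fourier f J * chi R J x =
    E (fun y => f y * (#|cube n|%:R * (y == x)%:R)).
  under [RHS]expectation_ext do rewrite -sum_chi_chi mulr_sumr.
  rewrite expectation_sum; apply: eq_bigr => J _.
  rewrite /fourier mulrC -expectationZ; apply: expectation_ext => y; ring.
rewrite /expectation (bigD1 x)//= eqxx mulr1 big1 ?addr0 => [|y /negbTE ->].
  by rewrite mulfK// gt_eqF// card_cube_gt0.
by rewrite !mulr0.
Qed.

End WalshFourier.

(** * Hypercontractivity for low degrees *)

Section Hypercontractivity.
Variables (R : realType) (n : nat).
Implicit Types (x y : cube n) (I J K S : {set 'I_n}).
Implicit Types (c : {set 'I_n} -> R).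
Local Notation E := (@expectation R n).

(** Splitting off the variable [i]: [walsh c = walsh (coef_free i c) +
    x_i * walsh (coef_deriv i c)], where neither polynomial involves [x_i]. *)
Definition coef_free (i : 'I_n) c J : R := if i \in J then 0 else c J.
Definition coef_deriv (i : 'I_n) c J : R := if i \in J then 0 else c (i |: J).

Lemma walsh_split i c x :
  walsh c x = walsh (coef_free i c) x
              + Defs.coord R x i * walsh (coef_deriv i c) x.
Proof.
rewrite /walsh (bigID (fun J : {set 'I_n} => i \in J))/= addrC; congr (_ + _).
  rewrite [RHS](bigID (fun J : {set 'I_n} => i \in J))/=.
  rewrite [X in _ = X + _]big1 => [|J iJ]; last by rewrite /coef_free iJ mul0r.
  by rewrite add0r; apply: eq_bigr => J /negbTE iJ; rewrite /coef_free iJ.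
rewrite (reindex_onto (fun K => i |: K) (fun J => J :\ i))/=; last first.
  by move=> J iJ; rewrite setD1K.
rewrite mulr_sumr [RHS](bigID (fun J : {set 'I_n} => i \in J))/=.
rewrite [X in _ = X + _]big1 => [|J iJ]; last by rewrite /coef_deriv iJ mul0r mulr0.
rewrite add0r; apply: eq_big => [J|J /andP[_ /eqP <-]]; last first.
  rewrite /coef_deriv setD11 setD1K ?setU11// {1}/chi (big_setD1 i) ?setU11//=.
  by rewrite mulrCA.
rewrite setU11/=; apply/eqP/idP => [<-|iJ]; first by rewrite setD11.
by rewrite setU1K.
Qed.

Lemma walsh_flip i c x :
  (forall J, i \in J -> c J = 0) -> walsh c (flip i x) = walsh c x.
Proof.
move=> ci; apply: eq_bigr => J _; rewrite chi_flip.
by case: ifPn => [/ci ->|_]; rewrite ?mul0r ?mul1r.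
Qed.

(** The hypercontractive inequality between the second and the fourth moment, by
    induction on the set [S] of variables that occur. With [p = a + x_i b], the terms odd
    in [x_i] have mean zero, so [E p^4 = E a^4 + 6 E (a b)^2 + E b^4] and
    [E p^2 = E a^2 + E b^2]; the mixed term is bounded by Cauchy-Schwarz, and [b] has
    smaller degree than [p]. *)
Lemma bonami_support c S D :
  (forall J, ~~ (J \subset S) -> c J = 0) ->
  (forall J, (D < #|J|)%N -> c J = 0) ->
  E (fun x => walsh c x ^+ 4) <= 9 ^+ D * E (fun x => walsh c x ^+ 2) ^+ 2.
Proof.
elim: {S}_.+1 {-2}S (ltnSn #|S|) c D => // k IH S Sk c D cS cD.
have [S0|[i iS]] := set_0Vmem S.
  have cE x : walsh c x = c set0.
    rewrite /walsh (bigD1 set0)//= chi0 mulr1 big1 ?addr0// => J J0.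
    by rewrite cS ?mul0r// S0 subset0.
  rewrite (@expectation_ext _ _ _ (fun=> c set0 ^+ 4)) => [|x]; last by rewrite cE.
  rewrite (@expectation_ext _ _ (fun x => _ ^+ 2) (fun=> c set0 ^+ 2)) => [|x]; last by rewrite cE.
  rewrite !expectation_cst -exprM -[leLHS]mul1r ler_wpM2r ?exprn_even_ge0//.
  by rewrite exprn_ege1// ler1n.
set ca := coef_free i c; set cb := coef_deriv i c.
set a := walsh ca; set b := walsh cb.
have ai x : a (flip i x) = a x.
  by apply: walsh_flip => J iJ; rewrite /ca /coef_free iJ.
have bi x : b (flip i x) = b x.
  by apply: walsh_flip => J iJ; rewrite /cb /coef_deriv iJ.
have xi x : Defs.coord R (flip i x) i = - Defs.coord R x i.
  by rewrite coord_flip eqxx mulN1r.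
have Sk' : (#|S :\ i| < k)%N.
  by move: Sk; rewrite (cardsD1 i S) iS add1n ltnS.
have JS J : i \notin J -> ~~ (J \subset S :\ i) -> ~~ (J \subset S).
  move=> iJ; apply: contraNN => JS; apply/subsetP => j jJ.
  by rewrite !inE (subsetP JS)// andbT; apply: contraNneq iJ => <-.
have E4 : E (fun x => walsh c x ^+ 4) = E (fun x => a x ^+ 4)
    + 6 * E (fun x => a x ^+ 2 * b x ^+ 2) + E (fun x => b x ^+ 4).
  rewrite (@expectation_ext _ _ _ (fun x => (a x ^+ 4
    + 6 * (a x ^+ 2 * b x ^+ 2)) + b x ^+ 4 + Defs.coord R x i *
      (4 * a x ^+ 3 * b x + 4 * a x * b x ^+ 3))); last first.
    move=> x; rewrite (walsh_split i) -/ca -/cb -/(a x) -/(b x).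
    have x2 := coord_sqr R x i; move: (Defs.coord R x i) x2 => z x2.
    have z2 : z ^+ 2 = 1 by rewrite expr2.
    have -> : (a x + z * b x) ^+ 4 = a x ^+ 4 + 6 * (a x ^+ 2 * b x ^+ 2) * z ^+ 2
       + b x ^+ 4 * (z ^+ 2) ^+ 2 + z * (4 * a x ^+ 3 * b x + 4 * a x * b x ^+ 3 * z ^+ 2)
       by ring.
    by rewrite z2; ring.
  rewrite !expectationD expectationZ [X in _ + X](@expectation_odd _ _ i) ?addr0//.
  by move=> x; rewrite xi ai bi mulNr.
have E2 : E (fun x => walsh c x ^+ 2) = E (fun x => a x ^+ 2) + E (fun x => b x ^+ 2).
  rewrite (@expectation_ext _ _ _ (fun x => (a x ^+ 2 + b x ^+ 2)
    + Defs.coord R x i * (2 * a x * b x))); last first.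
    move=> x; rewrite (walsh_split i) -/ca -/cb -/(a x) -/(b x).
    have x2 := coord_sqr R x i; move: (Defs.coord R x i) x2 => z x2.
    have z2 : z ^+ 2 = 1 by rewrite expr2.
    have -> : (a x + z * b x) ^+ 2 = a x ^+ 2 + b x ^+ 2 * z ^+ 2 + z * (2 * a x * b x) by ring.
    by rewrite z2; ring.
  rewrite !expectationD [X in _ + X](@expectation_odd _ _ i) ?addr0//.
  by move=> x; rewrite xi ai bi mulNr.
rewrite {}E4 {}E2.
have IHa : E (fun x => a x ^+ 4) <= 9 ^+ D * E (fun x => a x ^+ 2) ^+ 2.
  apply: (IH _ Sk') => J; rewrite /ca /coef_free; case: ifPn => // iJ.
    by move=> /JS => /(_ iJ)/cS.
  exact: cD.
have X0 : 0 <= E (fun x => a x ^+ 2 * b x ^+ 2).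
  by apply: expectation_ge0 => x; rewrite mulr_ge0 ?sqr_ge0.
have A0 : 0 <= E (fun x => a x ^+ 2) by apply: expectation_ge0 => x; rewrite sqr_ge0.
have B0 : 0 <= E (fun x => b x ^+ 2) by apply: expectation_ge0 => x; rewrite sqr_ge0.
have A40 : 0 <= E (fun x => a x ^+ 4) by apply: expectation_ge0 => x; rewrite exprn_even_ge0.
have B40 : 0 <= E (fun x => b x ^+ 4) by apply: expectation_ge0 => x; rewrite exprn_even_ge0.
case: D cD IHa => [|D] cD IHa.
  (* In degree 0 the polynomial b vanishes. *)
  have b0 x : b x = 0.
    rewrite /b /walsh big1// => J _; rewrite /cb /coef_deriv; case: ifPn => [|iJ].
      by rewrite mul0r.
    by rewrite cD ?mul0r// cardsU1 iJ.
  rewrite [X in _ + 6 * X](@expectation_ext _ _ _ (fun=> 0)) => [|x]; last first.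
    by rewrite b0 expr0n mulr0.
  rewrite [X in _ + X <= _](@expectation_ext _ _ _ (fun=> 0)) => [|x]; last first.
    by rewrite b0 expr0n.
  rewrite [X in (_ + X) ^+ 2](@expectation_ext _ _ _ (fun=> 0)) => [|x]; last first.
    by rewrite b0 expr0n.
  by rewrite !expectation_cst mulr0 !addr0.
have IHb : E (fun x => b x ^+ 4) <= 9 ^+ D * E (fun x => b x ^+ 2) ^+ 2.
  apply: (IH _ Sk') => J; rewrite /cb /coef_deriv; case: ifPn => // iJ.
    move=> /(JS _ iJ) JS'; apply: cS; apply: contraNN JS'.
    exact/subset_trans/subsetUr.
  by move=> DJ; apply: cD; rewrite cardsU1 iJ.
have CS := expectation_cauchy_schwarz (fun x => a x ^+ 2) (fun x => b x ^+ 2).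
rewrite [X in _ <= X * _](@expectation_ext _ _ _ (fun x => a x ^+ 4)) in CS; last first.
  by move=> x; rewrite -exprM.
rewrite [X in _ <= _ * X](@expectation_ext _ _ _ (fun x => b x ^+ 4)) in CS; last first.
  by move=> x; rewrite -exprM.
move: (E (fun x => a x ^+ 4)) (E (fun x => b x ^+ 4)) A40 B40
  (E (fun x => a x ^+ 2 * b x ^+ 2)) X0
  (E (fun x => a x ^+ 2)) (E (fun x => b x ^+ 2)) A0 B0 CS IHa IHb.
move=> A4 B4 A40 B40 X X0 A B A0 B0 CS; rewrite exprS.
have : 0 < 9 ^+ D :> R by rewrite exprn_gt0.
move: (9 ^+ D) => q q0 IHa IHb.
have AB0 := mulr_ge0 A0 B0.
have XAB : X <= 3 * q * (A * B).
  rewrite -(@ler_pXn2r _ 2)// ?nnegrE ?mulr_ge0 ?(ltW q0)//.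
  apply: le_trans CS _.
  have -> : (3 * q * (A * B)) ^+ 2 = (9 * q * A ^+ 2) * (q * B ^+ 2) by ring.
  by rewrite ler_pM.
have qB : 0 <= q * B ^+ 2 by rewrite mulr_ge0 ?sqr_ge0// ltW.
have -> : 9 * q * (A + B) ^+ 2
   = 9 * q * A ^+ 2 + 6 * (3 * q * (A * B)) + 9 * (q * B ^+ 2) by ring.
move: XAB IHa; set u := 3 * q * _; set v := 9 * q * _ => *; lra.
Qed.

Lemma bonami c D : (forall J, (D < #|J|)%N -> c J = 0) ->
  E (fun x => walsh c x ^+ 4) <= 9 ^+ D * (\sum_J c J ^+ 2) ^+ 2.
Proof.
move=> cD; rewrite -parseval; apply: (@bonami_support _ setT) => // J.
by rewrite subsetT.
Qed.

End Hypercontractivity.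

(** * Low-degree polynomials and small supports *)

Section AntiConcentration.
Variables (R : realType) (n : nat).
Implicit Types (x y : cube n) (I J K S : {set 'I_n}).
Implicit Types (c : {set 'I_n} -> R).
Local Notation E := (@expectation R n).

(** The probability that [u] does not vanish. *)
Definition prob_neq0 (u : cube n -> R) : R := E (fun x => (u x != 0)%:R).

Lemma prob_neq0_ge0 (u : cube n -> R) : 0 <= prob_neq0 u.
Proof. by apply: expectation_ge0 => x; rewrite ler0n. Qed.

Lemma sqr_neq0 (r : R) : (r != 0)%:R * r ^+ 2 = r ^+ 2.
Proof. by case: eqP => [->|_]; rewrite ?mul1r// expr0n mulr0. Qed.

Lemma sqr_bool (b : bool) : b%:R ^+ 2 = b%:R :> R.
Proof. by case: b; rewrite ?expr0n ?expr1n. Qed.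

(** A nonzero polynomial of degree at most [D] is nonzero with probability at
    least [9 ^- D] (Paley-Zygmund with the hypercontractive inequality). *)
Lemma low_degree_prob_neq0 c D x0 :
  (forall J, (D < #|J|)%N -> c J = 0) -> walsh c x0 != 0 ->
  1 <= 9 ^+ D * prob_neq0 (walsh c).
Proof.
move=> cD cx0; set M := E (fun x => walsh c x ^+ 2).
have M0 : 0 < M.
  rewrite lt_neqAle eq_sym; apply/andP; split; last first.
    by apply: expectation_ge0 => x; rewrite sqr_ge0.
  apply: contraNneq cx0 => M0; rewrite -sqrf_eq0.
  by rewrite (@expectation_eq0 _ _ (fun x => walsh c x ^+ 2)) => [//|x|]; rewrite ?sqr_ge0.
have H := expectation_cauchy_schwarz (fun x => (walsh c x != 0)%:R)
  (fun x => walsh c x ^+ 2).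
rewrite (expectation_ext (fun x => sqr_neq0 (walsh c x))) -/M in H.
rewrite (expectation_ext (fun x => sqr_bool (walsh c x != 0))) in H.
rewrite -/(prob_neq0 (walsh c)) in H.
rewrite (@expectation_ext _ _ _ (fun x => walsh c x ^+ 4)) in H; last first.
  by move=> x; rewrite -exprM.
have H' : M ^+ 2 <= prob_neq0 (walsh c) * (9 ^+ D * M ^+ 2).
  apply: le_trans H _; rewrite ler_wpM2l ?prob_neq0_ge0// /M parseval.
  exact: bonami.
rewrite -(@ler_pM2r _ (M ^+ 2)) ?exprn_gt0// mul1r.
by apply: le_trans H' _; rewrite le_eqVlt; apply/orP; left; apply/eqP; ring.
Qed.

(** A polynomial supported on a set of small probability has little weight in low degree.
    With [h] the truncation at degree [N], the weight [W] in question equals both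
    [E (walsh c * h)] and [E (h ^ 2)]; two applications of Cauchy-Schwarz bound it by the
    second moment of [walsh c], the probability of its support and the fourth moment of
    [h], to which hypercontractivity applies. *)
Lemma low_degree_weight c N :
  (\sum_(J : {set 'I_n} | (#|J| <= N)%N) c J ^+ 2) ^+ 2 <=
  9 ^+ N * prob_neq0 (walsh c) * (\sum_J c J ^+ 2) ^+ 2.
Proof.
set W := \sum_(J | _) _; set V := \sum_J _; set P := prob_neq0 _.
pose ch J := if (#|J| <= N)%N then c J else 0.
have chN J : (N < #|J|)%N -> ch J = 0 by rewrite ltnNge /ch => /negbTE ->.
have V0 : 0 <= V by apply: sumr_ge0 => J _; exact: sqr_ge0.
have W0 : 0 <= W by apply: sumr_ge0 => J _; exact: sqr_ge0.
have P0 : 0 <= P by exact: prob_neq0_ge0.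
have hW : \sum_J ch J ^+ 2 = W.
  rewrite /W [RHS]big_mkcond; apply: eq_bigr => J _; rewrite /ch.
  by case: ifP; rewrite ?expr0n.
have uh : E (fun x => walsh c x * ((walsh c x != 0)%:R * walsh ch x)) = W.
  rewrite (@expectation_ext _ _ _ (fun x => walsh c x * walsh ch x)).
    rewrite expectation_walshM -hW; apply: eq_bigr => J _.
    by rewrite /ch; case: ifP; rewrite ?expr0n ?mulr0.
  by move=> x; case: eqP => [->|_]; rewrite ?mul0r ?mul1r.
have H1 := expectation_cauchy_schwarz (walsh c)
  (fun x => (walsh c x != 0)%:R * walsh ch x).
rewrite uh parseval -/V in H1.
have H2 := expectation_cauchy_schwarz (fun x => (walsh c x != 0)%:R)
  (fun x => walsh ch x ^+ 2).
rewrite (expectation_ext (fun x => sqr_bool (walsh c x != 0))) -/(prob_neq0 _) -/P in H2.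
rewrite [X in _ <= _ * X](@expectation_ext _ _ _ (fun x => walsh ch x ^+ 4)) in H2; last first.
  by move=> x; rewrite -exprM.
rewrite (@expectation_ext _ _ _ (fun x => (walsh c x != 0)%:R * walsh ch x ^+ 2)) in H1; last first.
  by move=> x; rewrite exprMn sqr_bool.
move: H1 H2; set Q := E _ => H1 H2.
have Q0 : 0 <= Q.
  by apply: expectation_ge0 => x; rewrite mulr_ge0 ?sqr_ge0 ?ler0n.
have H3 : Q ^+ 2 <= P * (9 ^+ N * W ^+ 2).
  by apply: le_trans H2 _; rewrite ler_wpM2l// -hW bonami.
move: W0; rewrite le_eqVlt => /predU1P[<-|W0].
  by rewrite expr0n/= mulr_ge0 ?sqr_ge0// mulr_ge0// exprn_ge0.
rewrite -(@ler_pM2r _ (W ^+ 2)) ?exprn_gt0// -exprD.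
have -> : W ^+ (2 + 2) = (W ^+ 2) ^+ 2 by rewrite -exprM.
apply: (@le_trans _ _ ((V * Q) ^+ 2)).
  by rewrite lerXn2r// nnegrE ?sqr_ge0// mulr_ge0.
rewrite exprMn; apply: (le_trans (ler_wpM2l (sqr_ge0 V) H3)).
by rewrite le_eqVlt; apply/orP; left; apply/eqP; ring.
Qed.

End AntiConcentration.

(** * Grid-valued functions *)

Section Granularity.
Variables (R : realType) (n : nat).
Implicit Types (f h : cube n -> R) (x y : cube n) (I J K S : {set 'I_n}).
Implicit Types (c : {set 'I_n} -> R).
Local Notation E := (@expectation R n).

(** [h] takes its values in the grid [2 ^- k * Z]. *)
Definition granular (k : nat) h := forall x, 2 ^+ k * h x \is a Num.int.

Lemma granularW k l h : (k <= l)%N -> granular k h -> granular l h.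
Proof.
move=> kl hk x; rewrite -(subnK kl) exprD -mulrA rpredM// rpredX//.
exact: natr_int.
Qed.

Lemma granularB k f h :
  granular k f -> granular k h -> granular k (fun x => f x - h x).
Proof. by move=> fk hk x; rewrite mulrBr rpredB. Qed.

Lemma granular_walsh k c :
  (forall J, 2 ^+ k * c J \is a Num.int) -> granular k (walsh c).
Proof.
move=> ck x; rewrite /walsh mulr_sumr rpred_sum// => J _.
rewrite mulrA rpredM// /chi rpred_prod// => j _.
by rewrite /Defs.coord rpredX// rpredN rpred1.
Qed.

Lemma int_norm_le_sqr (z : R) : z \is a Num.int -> `|z| <= z ^+ 2.
Proof.
move=> zi; have [->|z0] := eqVneq z 0; first by rewrite normr0 expr0n.
by rewrite -real_normK ?num_real// expr2 ler_peMl// norm_intr_ge1.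
Qed.

Lemma granular_norm_le k h x : granular k h -> `|h x| <= 2 ^+ k * h x ^+ 2.
Proof.
move=> hk; have := int_norm_le_sqr (hk x).
have k0 : 0 < 2 ^+ k :> R by rewrite exprn_gt0.
by rewrite normrM gtr0_norm// exprMn expr2 -mulrA ler_pM2l.
Qed.

Lemma granular_prob_neq0 k h :
  granular k h -> prob_neq0 h <= 4 ^+ k * E (fun x => h x ^+ 2).
Proof.
move=> hk; rewrite -expectationZ; apply: le_expectation => x.
have -> : 4 ^+ k * h x ^+ 2 = (2 ^+ k * h x) ^+ 2.
  by rewrite exprMn -exprM mulnC exprM; congr (_ ^+ k * _); ring.
case: eqP => [->|/eqP h0]; first by rewrite mulr0 expr0n.
rewrite -real_normK ?num_real// exprn_ege1// norm_intr_ge1//.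
by rewrite mulf_neq0// expf_neq0// pnatr_eq0.
Qed.

Lemma granular_low_degree_weight c k N : granular k (walsh c) ->
  (\sum_(J : {set 'I_n} | (#|J| <= N)%N) c J ^+ 2) ^+ 2 <=
  9 ^+ N * 4 ^+ k * (\sum_J c J ^+ 2) ^+ 3.
Proof.
move=> ck; apply: le_trans (low_degree_weight c N) _.
have V0 : 0 <= \sum_J c J ^+ 2 by apply: sumr_ge0 => J _; exact: sqr_ge0.
have := granular_prob_neq0 ck; rewrite parseval => H.
rewrite -!mulrA ler_wpM2l ?exprn_ge0// [_ ^+ 3]exprS !mulrA.
by do 2 apply: ler_wpM2r => //.
Qed.

(** The coefficients of the sets containing [I]: up to the factor [chi_I], the
    Walsh polynomial of [coef_above I (fourier f)] is the iterated discrete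
    derivative of [f] along [I]. *)
Definition coef_above I c J : R := if I \subset J then c J else 0.

(** Adding [i] to [I] amounts to taking the part that is odd in [x_i]. *)
Lemma walsh_above_setU1 i I c x : i \notin I ->
  walsh (coef_above (i |: I) c) x =
  (walsh (coef_above I c) x - walsh (coef_above I c) (flip i x)) / 2.
Proof.
move=> iI; rewrite /walsh -sumrB mulr_suml; apply: eq_bigr => J _.
rewrite chi_flip /coef_above subUset sub1set.
by case: (i \in J); case: (I \subset J) => /=; field.
Qed.

(** Each step of the induction on [#|I|] halves a difference of two values. *)
Lemma granular_above f I : sign_valued f ->
  granular #|I| (walsh (coef_above I (fourier f))).
Proof.
move=> fs; move Ek: #|I| => k; elim: k I Ek => [|k IH] I Ik x.
  move/eqP: Ik; rewrite cards_eq0 => /eqP ->; rewrite expr0 mul1r.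
  have -> : walsh (coef_above set0 (fourier f)) x = f x.
    rewrite [RHS]fourier_inversion; apply: eq_bigr => J _.
    by rewrite /coef_above sub0set.
  by case: (fs x) => ->; rewrite ?rpredN rpred1.
have [i iI] : exists i, i \in I by apply/card_gt0P; rewrite Ik.
rewrite -(setD1K iI) walsh_above_setU1 ?setD11//.
have -> (u v : R) : 2 ^+ k.+1 * ((u - v) / 2) = 2 ^+ k * u - 2 ^+ k * v.
  by rewrite exprS; field.
have Ik' : #|I :\ i| = k by move: Ik; rewrite (cardsD1 i I) iI add1n => -[].
by rewrite rpredB// IH.
Qed.

(** A point of the grid [2 ^- k * Z] nearest to [r]. *)
Definition grid_round (k : nat) (r : R) : R :=
  (Num.floor (2 ^+ k * r + 2^-1))%:~R / 2 ^+ k.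

Lemma grid_round_int k r : 2 ^+ k * grid_round k r \is a Num.int.
Proof. by rewrite mulrC divfK ?expf_neq0 ?pnatr_eq0// intr_int. Qed.

Lemma grid_round_dist k r : 2 ^+ k * `|r - grid_round k r| <= 2^-1.
Proof.
have k0 : 0 < 2 ^+ k :> R by rewrite exprn_gt0.
rewrite -{1}(gtr0_norm k0) -normrM mulrBr [X in _ - X]mulrC divfK ?gt_eqF//.
have /andP[] := floor_itv (2 ^+ k * r + 2^-1).
rewrite intrD; set z := (Num.floor _)%:~R; move: (2 ^+ k * r) => y; rewrite ler_norml => ? ?.
apply/andP; split; lra.
Qed.

(** A coefficient of a grid-valued polynomial that lies within half a grid step of
    zero is controlled by the sum of the squares of the other coefficients:
    [|c I| <= E |walsh c| <= 2 ^ k * E ((walsh c) ^ 2)], and the contribution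
    of [I] itself to the right-hand side is at most [|c I| / 2]. *)
Lemma granular_coef_le c k I : granular k (walsh c) ->
  2 ^+ k * `|c I| <= 2^-1 ->
  `|c I| <= 2 ^+ k.+1 * \sum_(J | J != I) c J ^+ 2.
Proof.
move=> ck cI.
have H : `|c I| <= 2 ^+ k * (c I ^+ 2 + \sum_(J | J != I) c J ^+ 2).
  rewrite [X in _ * X](_ : _ = \sum_J c J ^+ 2); last by rewrite [RHS](bigD1 I).
  rewrite -parseval -expectationZ.
  rewrite -(fourier_walsh c I) /fourier; apply: le_trans (ler_norm_expectation _) _.
  apply: le_expectation => x; rewrite normrM chi_norm mulr1.
  exact: granular_norm_le.
have H2 : 2 ^+ k * c I ^+ 2 <= 2^-1 * `|c I|.
  by rewrite -[c I ^+ 2]real_normK ?num_real// expr2 mulrA ler_wpM2r.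
rewrite exprS -mulrA; rewrite mulrDr in H.
move: H H2; move: (2 ^+ k * _) (2 ^+ k * _) => u v; lra.
Qed.

End Granularity.


(** * Counting the sets above a given set *)

Section Counting.

Lemma leq_exp_base a b p : (a <= b -> a ^ p <= b ^ p)%N.
Proof. by case: p => // p ab; rewrite leq_exp2r. Qed.

Lemma bin_le_exp m s : ('C(m, s) <= m ^ s)%N.
Proof.
elim: m s => [|m IH] [|s] //.
rewrite binS; apply: (@leq_trans (m ^ s.+1 + m ^ s)); first exact: leq_add.
by rewrite expnS -[X in (_ + X)%N]mul1n -mulnDl addn1 expnS leq_mul2l leq_exp_base ?orbT.
Qed.

Lemma exp_le_fact_bin M m : (M.+1 ^ m <= m`! * 'C(M + m, m))%N.
Proof.
rewrite mulnC bin_ffact; elim: m => [|m IH] //.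
by rewrite addnS ffactSS expnS leq_mul// ltnS leq_addr.
Qed.

Variable n : nat.
Implicit Types I J K S : {set 'I_n}.

Lemma card_between I J s : I \subset J ->
  #|[set K : {set 'I_n} | [&& I \subset K, K \subset J & #|K| == (#|I| + s)%N]]|
  = 'C(#|J| - #|I|, s).
Proof.
move=> IJ; rewrite -(cardsDS IJ) -cards_draws.
have disj S : S \subset J :\: I -> [disjoint I & S].
  by rewrite subsetD disjoint_sym => /andP[].
rewrite -[RHS](@card_in_imset _ _ (fun S => I :|: S)) => [|S S'].
  congr #|pred_of_set _|; apply/setP => K; rewrite inE.
  apply/and3P/imsetP => [[IK KJ /eqP cK]|[S]].
    exists (K :\: I); last by rewrite -{1}(setID K I) (setIidPr IK).
    by rewrite inE setSD//= cardsDS// cK addKn.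
  rewrite inE => /andP[SJ /eqP cS ->]; split; first exact: subsetUl.
    by rewrite subUset IJ (subset_trans SJ)// subsetDl.
  have := cardsU I S; rewrite (disjoint_setI0 (disj _ SJ)) cards0 subn0 cS => ->.
  by [].
rewrite !inE => /andP[SJ _] /andP[SJ' _] ISS'.
have D (T : {set 'I_n}) : T \subset J :\: I -> (I :|: T) :\: I = T.
  move=> TJ; rewrite setDUl setDv set0U; apply/setDidPl.
  by rewrite disjoint_sym disj.
by rewrite -(D _ SJ) ISS' D.
Qed.

Lemma card_above I s :
  (#|[set K : {set 'I_n} | I \subset K & #|K| == (#|I| + s)%N]| <= n ^ s)%N.
Proof.
have -> : [set K : {set 'I_n} | I \subset K & #|K| == (#|I| + s)%N] =
  [set K : {set 'I_n} | [&& I \subset K, K \subset setT & #|K| == (#|I| + s)%N]].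
  by apply/setP => K; rewrite !inE subsetT.
rewrite card_between ?subsetT// (leq_trans (bin_le_exp _ _))//.
by rewrite leq_exp_base// cardsT card_ord leq_subr.
Qed.

(** Double counting: if every [J] satisfying [P] contains at least [q] of the sets [K] of
    size [#|I| + s] above [I], then summing [F] over the [J] above each [K] counts every
    such [J] at least [q] times. *)
Lemma sum_above_le (R : realType) I s (P : pred {set 'I_n})
    (F : {set 'I_n} -> R) q :
  (forall J, 0 <= F J) ->
  (forall J, P J -> I \subset J /\ (q <= 'C(#|J| - #|I|, s))%N) ->
  q%:R * (\sum_(J | P J) F J) <=
  \sum_(K : {set 'I_n} | (I \subset K) && (#|K| == (#|I| + s)%N))
     \sum_(J : {set 'I_n} | (K \subset J) && P J) F J.
Proof.
move=> F0 qP; rewrite (exchange_big_dep P)/=; last by move=> K J _ /andP[].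
rewrite mulr_sumr; apply: ler_sum => J PJ.
have [IJ qJ] := qP _ PJ.
rewrite sumr_const -[leRHS]mulr_natl ler_wpM2r// ler_nat (leq_trans qJ)//.
rewrite -(card_between s IJ) subset_leq_card//; apply/subsetP => K.
by rewrite !inE unfold_in => /and3P[-> -> ->]; rewrite PJ.
Qed.

End Counting.

(** * Estimates for the scale ln n / n *)

Section LogarithmicEstimates.
Variable R : realType.

Lemma pow_le_expR (y : R) p : 0 <= y -> y ^+ p <= p%:R ^+ p * expR y.
Proof.
case: p => [|p] y0; first by rewrite !expr0 mul1r -expR0 ler_expR.
have p0 : 0 < p.+1%:R :> R by rewrite ltr0n.
have H : y / p.+1%:R <= expR (y / p.+1%:R).
  by apply: le_trans (expR_ge1Dx _); rewrite lerDr.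
have -> : expR y = expR (y / p.+1%:R) ^+ p.+1.
  by rewrite -expRM_natl mulrC divfK// gt_eqF.
rewrite -exprMn; apply: lerXn2r; rewrite ?nnegrE//.
  by rewrite mulr_ge0// expR_ge0.
by rewrite mulrC -ler_pdivrMr.
Qed.

Variable n : nat.
Hypothesis n_gt1 : (1 < n)%N.

Local Notation L := (ln n%:R : R).

(** The scale [ln n / n] of the influence bound. *)
Definition tau : R := ln n%:R / n%:R.

(** The square root of [n]. *)
Definition rt : R := expR (ln n%:R / 2).

Let n_gt0 : 0 < n%:R :> R.
Proof. by rewrite ltr0n ltnW. Qed.

Lemma rt_sqr : rt ^+ 2 = n%:R.
Proof. by rewrite -expRM_natl mulrC divfK ?pnatr_eq0// lnK. Qed.

Lemma rt_gt0 : 0 < rt. Proof. exact: expR_gt0. Qed.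

Lemma ln_gt0n : 0 < L.
Proof. by rewrite ln_gt0// ltr1n. Qed.

Lemma tau_gt0 : 0 < tau.
Proof. by rewrite divr_gt0// ln_gt0n. Qed.

Lemma mul_tau : n%:R * tau = L.
Proof. by rewrite mulrC divfK// gt_eqF. Qed.

Lemma tau_le1 : tau <= 1.
Proof.
rewrite ler_pdivrMr// mul1r; apply: le_trans (_ : n%:R - 1 <= _); last by rewrite gerBl.
have := @le_ln1Dx R (n%:R - 1); rewrite [1 + _]addrC subrK; apply.
by rewrite ltrBrDr addNr.
Qed.

(** Powers of the logarithm up to the exponent [d + 2] are at most this constant
    times the square root of [n]. *)
Definition log_const (d : nat) : nat := ((2 * d.+2) ^ d.+2)%N.

Lemma ln_pow_le d p : (p <= d.+2)%N -> L ^+ p <= (log_const d)%:R * rt.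
Proof.
move=> pd; have L2 : 0 <= L / 2 by rewrite divr_ge0// ltW// ln_gt0n.
have -> : L = 2 * (L / 2) by rewrite mulrC divfK ?pnatr_eq0.
rewrite exprMn; apply: (@le_trans _ _ (2 ^+ p * (p%:R ^+ p * rt))).
  by rewrite ler_wpM2l ?exprn_ge0// pow_le_expR.
rewrite mulrA ler_wpM2r ?(ltW rt_gt0)// -exprMn -natrM -natrX ler_nat.
apply: (@leq_trans ((2 * d.+2) ^ p)).
  by rewrite leq_exp_base// leq_mul2l pd orbT.
by rewrite leq_pexp2l.
Qed.

(** The cut in the degrees is made at [d + M] with [M = trunc_log 9 n]: then [3 ^ M], the
    loss of the hypercontractive inequality, is at most the square root of [n], while
    [M + 1] is at least [ln n / 9]. *)
Lemma trunc_log_le_rt : 3 ^+ trunc_log 9 n <= rt.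
Proof.
rewrite -(@ler_pXn2r _ 2)// ?nnegrE ?exprn_ge0 ?(ltW rt_gt0)//.
rewrite rt_sqr -exprM mulnC exprM -natrX -natrX ler_nat.
by apply: trunc_logP => //; exact: ltnW.
Qed.

Lemma ln_le_trunc_log : L <= 9 * (trunc_log 9 n).+1%:R.
Proof.
apply: (@le_trans _ _ (ln (9 ^+ (trunc_log 9 n).+1))).
  rewrite ler_ln ?posrE ?exprn_gt0//.
  by rewrite -natrX ler_nat ltnW// trunc_log_ltn.
rewrite lnXn// -[leLHS]mulr_natr ler_wpM2r//.
have := @le_ln1Dx R 8; have -> : 1 + 8 = 9 :> R by ring.
by move=> /(_ ltac:(lra)); lra.
Qed.

Lemma ln_pow_tau_le d p : (p <= d.+1)%N -> L ^+ p * tau <= (log_const d)%:R.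
Proof.
move=> pd; have r0 := rt_gt0; have -> : L ^+ p * tau = L ^+ p.+1 / rt ^+ 2.
  by rewrite rt_sqr /tau exprSr mulrA.
rewrite ler_pdivrMr ?exprn_gt0// expr2 mulrA.
apply: le_trans (@ln_pow_le d p.+1 _) _ => //.
rewrite ler_peMr ?mulr_ge0 ?(ltW r0)//.
by rewrite -(@ler_pXn2r _ 2)// ?nnegrE ?(ltW r0)// rt_sqr expr1n ler1n ltnW.
Qed.

End LogarithmicEstimates.

(** The weight above [I] in degrees exceeding [d] is at most this constant times
    [alpha * tau ^ #|I|]; the summands come from the degrees above and below a cut of
    order [ln n]. *)
Definition tail_const (d : nat) : nat :=
  (9 ^ d.+1 * d.+1`! + 3 ^ d * 2 ^ d.+1 * log_const d)%N.

Section HighDegreeWeight.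
Variables (R : realType) (n d : nat) (f : cube n -> R) (alpha : R).
Hypotheses (d_gt0 : (1 <= d)%N) (dn : (d < n)%N) (f_sign : sign_valued f).
Hypotheses (alpha_gt0 : 0 < alpha) (alpha_le1 : alpha <= 1).
Hypothesis infl : forall I : {set 'I_n}, #|I| = d.+1 ->
  T_influence I f <= alpha * tau R n ^+ d.+1.
Implicit Types I J K : {set 'I_n}.

Local Notation t := (tau R n).
Local Notation L := (ln n%:R : R).
Local Notation a := (fourier f).

Let n_gt1 : (1 < n)%N. Proof. exact: leq_ltn_trans dn. Qed.
Let t_gt0 : 0 < t. Proof. exact: tau_gt0. Qed.
Let t_le1 : t <= 1. Proof. exact: tau_le1. Qed.
Let L_gt0 : 0 < L. Proof. exact: ln_gt0n. Qed.

(** The number of sets [K] to sum over is at most [n ^ m], and [n * tau = ln n]. *)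
Lemma sum_above_cst_le I m (X : R) : 0 <= X -> (#|I| + m = d.+1)%N ->
  \sum_(K : {set 'I_n} | (I \subset K) && (#|K| == (#|I| + m)%N)) (X * t ^+ d.+1)
  <= X * L ^+ m * t ^+ #|I|.
Proof.
move=> X0 Im; rewrite sumr_const -[leLHS]mulr_natl.
have -> : X * L ^+ m * t ^+ #|I| = n%:R ^+ m * (X * t ^+ d.+1).
  by rewrite -Im exprD -(mul_tau R n_gt1) exprMn; ring.
rewrite ler_wpM2r ?mulr_ge0 ?exprn_ge0 ?(ltW t_gt0)// -natrX ler_nat.
by apply: leq_trans (card_above I m); rewrite cardsE.
Qed.

Lemma T_influenceE K : T_influence K f = \sum_J coef_above K a J ^+ 2.
Proof.
rewrite /T_influence big_mkcond; apply: eq_bigr => J _; rewrite /coef_above.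
by case: ifP; rewrite ?expr0n.
Qed.

(** The weight is at most [3 ^ N * 2 ^ (d + 1)] times the power [3 / 2] of the influence of
    [K]; the factor [tau] bounds [(alpha * tau ^ (d + 1)) ^ (1 / 2)], as [d >= 1]. *)
Lemma infl_low_degree K N : #|K| = d.+1 ->
  \sum_(J : {set 'I_n} | (K \subset J) && (#|J| <= N)%N) a J ^+ 2
  <= (3 ^+ N * 2 ^+ d.+1 * alpha * t) * t ^+ d.+1.
Proof.
move=> cK; have := @granular_above _ _ _ K f_sign; rewrite cK.
move=> /granular_low_degree_weight => /(_ N); rewrite -T_influenceE.
have -> : \sum_(J : {set 'I_n} | (#|J| <= N)%N) coef_above K a J ^+ 2 =
    \sum_(J : {set 'I_n} | (K \subset J) && (#|J| <= N)%N) a J ^+ 2.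
  rewrite big_mkcondl; apply: eq_bigr => J _; rewrite /coef_above.
  by case: ifP; rewrite ?expr0n.
move=> H.
have infl0 : 0 <= T_influence K f by apply: sumr_ge0 => J _; exact: sqr_ge0.
have W0 : 0 <= \sum_(J : {set 'I_n} | (K \subset J) && (#|J| <= N)%N) a J ^+ 2.
  by apply: sumr_ge0 => J _; exact: sqr_ge0.
set X := alpha * t ^+ d.+1.
have X0 : 0 <= X by rewrite mulr_ge0 ?exprn_ge0// ltW.
have Xt : X <= t ^+ 2.
  rewrite /X -(subnKC d_gt0) -[(1 + (d - 1)).+1]addSn exprD mulrCA.
  rewrite ler_piMr ?exprn_ge0 ?(ltW t_gt0)//.
  by rewrite mulr_ile1 ?exprn_ge0 ?exprn_ile1 ?(ltW t_gt0) ?(ltW alpha_gt0).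
have -> : 3 ^+ N * 2 ^+ d.+1 * alpha * t * t ^+ d.+1 = 3 ^+ N * 2 ^+ d.+1 * (X * t).
  by rewrite /X; ring.
have q0 : 0 <= 3 ^+ N * 2 ^+ d.+1 :> R by rewrite mulr_ge0 ?exprn_ge0.
have qXt := mulr_ge0 q0 (mulr_ge0 X0 (ltW t_gt0)).
rewrite -(@ler_pXn2r _ 2)//.
apply: le_trans H _; rewrite exprMn [(3 ^+ N * _) ^+ 2]exprMn [(X * t) ^+ 2]exprMn.
have -> : (3 ^+ N) ^+ 2 = 9 ^+ N :> R by rewrite -exprM mulnC exprM; congr (_ ^+ N); ring.
have -> : (2 ^+ d.+1) ^+ 2 = 4 ^+ d.+1 :> R by rewrite -exprM mulnC exprM; congr (_ ^+ d.+1); ring.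
rewrite ler_wpM2l ?mulr_ge0 ?exprn_ge0//.
apply: (@le_trans _ _ (X ^+ 3)); first by rewrite lerXn2r ?nnegrE// infl.
by rewrite exprSr ler_wpM2l ?exprn_ge0.
Qed.

(** The weight of [f] above [I] in degrees exceeding [d]. The degrees are cut at
    [N = d + M] where [M] is of order [ln n]: beyond the cut each [J]
    above [I] contains at least a multiple of [(ln n) ^ m] of the sets [K] of size
    [d + 1] above [I], which gains over the trivial bound on the sum of the
    influences of the [K]; below the cut the hypercontractive bound applies to each
    [K]. *)
Lemma tail_weight_le I : (#|I| <= d)%N ->
  \sum_(J : {set 'I_n} | (I \subset J) && (d < #|J|)%N) a J ^+ 2
  <= (tail_const d)%:R * alpha * t ^+ #|I|.
Proof.
move=> Id; set m := (d.+1 - #|I|)%N.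
have Im : (#|I| + m = d.+1)%N by rewrite subnKC// ltnW.
have md : (m <= d.+1)%N by rewrite leq_subr.
have m0 : (0 < m)%N by rewrite subn_gt0 ltnS.
set M := trunc_log 9 n; set N := (d + M)%N.
have a0 J : 0 <= a J ^+ 2 by exact: sqr_ge0.
have tk0 : 0 <= t ^+ #|I| by rewrite exprn_ge0// ltW.
have high : \sum_(J : {set 'I_n} | (I \subset J) && (N < #|J|)%N) a J ^+ 2
    <= (9 ^ d.+1 * d.+1`!)%:R * alpha * t ^+ #|I|.
  set W := \sum_(J | _) _.
  have W0 : 0 <= W by apply: sumr_ge0.
  have H : 'C(M + m, m)%:R * W <= alpha * L ^+ m * t ^+ #|I|.
    apply: le_trans (sum_above_cst_le (ltW alpha_gt0) Im).
    apply: (@le_trans _ _ (\sum_(K : {set 'I_n} | (I \subset K) && (#|K| == (#|I| + m)%N))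
       \sum_(J : {set 'I_n} | (K \subset J) && ((I \subset J) && (N < #|J|)%N)) a J ^+ 2)).
      apply: sum_above_le => // J /andP[IJ NJ]; split => //.
      by apply: leq_bin2l; rewrite /N in NJ; lia.
    apply: ler_sum => K /andP[_ /eqP cK].
    rewrite Im in cK; apply: le_trans (infl cK).
    rewrite /T_influence big_mkcondr/=; apply: ler_sum => J _.
    by case: ifP.
  have LM : L ^+ m <= 9 ^+ m * (m`! * 'C(M + m, m))%:R.
    apply: (@le_trans _ _ (9 ^+ m * (M.+1 ^ m)%:R)).
      by rewrite natrX -exprMn lerXn2r ?nnegrE ?(ltW L_gt0) ?ln_le_trunc_log// mulr_ge0.
    by rewrite ler_wpM2l ?exprn_ge0// ler_nat exp_le_fact_bin.
  have Lm : 0 < L ^+ m by rewrite exprn_gt0.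
  rewrite -(ler_pM2l Lm).
  apply: (@le_trans _ _ ((9 ^ m * m`!)%:R * (alpha * L ^+ m * t ^+ #|I|))).
    apply: (@le_trans _ _ ((9 ^ m * m`!)%:R * ('C(M + m, m)%:R * W))).
      rewrite mulrA ler_wpM2r// (le_trans LM)// natrM natrM natrX.
      by rewrite mulrA.
    by rewrite ler_wpM2l.
  rewrite [leLHS](_ : _ = (9 ^ m * m`!)%:R * (L ^+ m * (alpha * t ^+ #|I|))); last by ring.
  rewrite [leRHS](_ : _ = (9 ^ d.+1 * d.+1`!)%:R * (L ^+ m * (alpha * t ^+ #|I|))); last by ring.
  rewrite ler_wpM2r ?mulr_ge0// ?(ltW Lm) ?(ltW alpha_gt0)// ler_nat leq_mul ?leq_pexp2l//.
  exact: leq_fact.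
have low : \sum_(J : {set 'I_n} | (I \subset J) && (d < #|J| <= N)%N) a J ^+ 2
    <= (3 ^ d * 2 ^ d.+1 * log_const d)%:R * alpha * t ^+ #|I|.
  pose X := 3 ^+ N * 2 ^+ d.+1 * alpha * t.
  have X0 : 0 <= X.
    apply: mulr_ge0 (ltW t_gt0); apply: mulr_ge0 (ltW alpha_gt0).
    by apply: mulr_ge0; apply: exprn_ge0.
  have H : 1%:R * (\sum_(J : {set 'I_n} | (I \subset J) && (d < #|J| <= N)%N) a J ^+ 2)
      <= X * L ^+ m * t ^+ #|I|.
    apply: le_trans (sum_above_cst_le X0 Im).
    apply: (@le_trans _ _ (\sum_(K : {set 'I_n} | (I \subset K) && (#|K| == (#|I| + m)%N))
       \sum_(J : {set 'I_n} | (K \subset J) && ((I \subset J) && (d < #|J| <= N)%N)) a J ^+ 2)).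
      apply: sum_above_le => // J /andP[IJ /andP[dJ _]]; split => //.
      by rewrite bin_gt0; lia.
    apply: ler_sum => K /andP[_ /eqP cK].
    rewrite Im in cK; apply: le_trans (infl_low_degree N cK).
    rewrite [leLHS]big_mkcond [leRHS]big_mkcond/=; apply: ler_sum => J _.
    by case: (K \subset J) => //=; case: (I \subset J); case: (d < _)%N; case: (_ <= N)%N.
  rewrite mul1r in H; apply: le_trans H _.
  rewrite ler_wpM2r// /X exprD.
  rewrite [leLHS](_ : _ = (3 ^+ d * 2 ^+ d.+1 * alpha) * (3 ^+ M * (t * L ^+ m))); last by ring.
  rewrite [leRHS](_ : _ = (3 ^+ d * 2 ^+ d.+1 * alpha) * (log_const d)%:R); last first.
    by rewrite !natrM !natrX; ring.
  rewrite ler_wpM2l ?mulr_ge0 ?exprn_ge0 ?(ltW alpha_gt0)//.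
  have -> : t * L ^+ m = L ^+ m.+1 / rt R n ^+ 2.
    by rewrite rt_sqr// /tau exprS; ring.
  have r0 := rt_gt0 R n.
  rewrite mulrA ler_pdivrMr ?exprn_gt0//.
  rewrite [leRHS](_ : _ = rt R n * ((log_const d)%:R * rt R n)); last by ring.
  rewrite ler_pM ?exprn_ge0 ?(ltW L_gt0)//.
    exact: trunc_log_le_rt.
  by apply: ln_pow_le => //; rewrite ltnS.
rewrite (bigID (fun J : {set 'I_n} => (#|J| <= N)%N))/= natrD !mulrDl addrC.
apply: lerD.
  rewrite [leLHS](eq_bigl (fun J : {set 'I_n} => (I \subset J) && (N < #|J|)%N)) //.
  move=> J /=; rewrite -ltnNge; case: (I \subset J) => //=.
  case: (ltnP N #|J|) => NJ; rewrite ?andbT ?andbF//.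
  exact: leq_ltn_trans (leq_addr _ _) NJ.
by rewrite [leLHS](eq_bigl (fun J : {set 'I_n} => (I \subset J) && (d < #|J| <= N)%N)) // => J;
  rewrite -andbA.
Qed.

End HighDegreeWeight.

(** * Rounding the Fourier coefficients *)

Section ErrorConstants.
Variable R : realType.

(** If the errors at the sets [J] strictly above [I] with [#|J| <= d] are at most
    [C * alpha * tau ^ #|J|], then the squares of all the errors strictly above [I] add up
    to at most this constant times [alpha * tau ^ #|I|]. *)
Definition above_const (d : nat) (C : R) : R :=
  (tail_const d)%:R + (d * log_const d)%:R * C ^+ 2.

(** The error at a set [I] with [d + 1 - j <= #|I| <= d] is at most this constant times
    [alpha * tau ^ #|I|]; [j] increases in the descent through the levels. *)
Fixpoint err_const (d j : nat) : R :=
  if j is j'.+1 then 2 ^+ d.+1 * above_const d (err_const d j') + err_const d j'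
  else 0.

(** The mean squared distance between [f] and its approximation is at most this constant
    times [alpha]. *)
Definition dist_const (d : nat) : R :=
  above_const d (err_const d d.+1) + err_const d d.+1 ^+ 2.

Lemma above_const_ge0 d C : 0 <= above_const d C.
Proof. by rewrite addr_ge0// mulr_ge0// sqr_ge0. Qed.

Lemma err_const_ge0 d j : 0 <= err_const d j.
Proof.
elim: j => //= j IH; apply: addr_ge0 IH; apply: mulr_ge0; first exact: exprn_ge0.
exact: above_const_ge0.
Qed.

Lemma dist_const_ge0 d : 0 <= dist_const d.
Proof. by apply: addr_ge0; [exact: above_const_ge0 | exact: sqr_ge0]. Qed.

End ErrorConstants.

Section Rounding.
Variables (R : realType) (n d : nat) (f : cube n -> R) (alpha : R).
Hypotheses (d_gt0 : (1 <= d)%N) (dn : (d < n)%N) (f_sign : sign_valued f).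
Hypotheses (alpha_gt0 : 0 < alpha) (alpha_le1 : alpha <= 1).
Hypothesis infl : forall I : {set 'I_n}, #|I| = d.+1 ->
  T_influence I f <= alpha * tau R n ^+ d.+1.
Implicit Types I J K : {set 'I_n}.

Local Notation t := (tau R n).
Local Notation L := (ln n%:R : R).
Local Notation a := (fourier f).

Let n_gt1 : (1 < n)%N. Proof. exact: leq_ltn_trans dn. Qed.
Let t_gt0 : 0 < t. Proof. exact: tau_gt0. Qed.
Let t_le1 : t <= 1. Proof. exact: tau_le1. Qed.
Let L_gt0 : 0 < L. Proof. exact: ln_gt0n. Qed.

(** The Fourier coefficients of [f] of degree at most [d], rounded to the grid
    [2 ^- d * Z]; these are the coefficients of the approximating function. *)
Definition rounded_coef J : R :=
  if (#|J| <= d)%N then grid_round d (a J) else 0.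

Definition coef_err J : R := a J - rounded_coef J.

Local Notation b := rounded_coef.
Local Notation e := coef_err.

Lemma rounded_coef_int J : 2 ^+ d * b J \is a Num.int.
Proof.
rewrite /rounded_coef; case: ifP => _; first exact: grid_round_int.
by rewrite mulr0 rpred0.
Qed.

Lemma granular_err_above I : (#|I| <= d)%N -> granular d (walsh (coef_above I e)).
Proof.
move=> Id x; have -> : walsh (coef_above I e) x =
    walsh (coef_above I a) x - walsh (coef_above I b) x.
  rewrite /walsh -sumrB; apply: eq_bigr => J _; rewrite -mulrBl /coef_above.
  by case: ifP; rewrite ?subr0.
apply: (@granularB _ _ d) x => [|x].
  exact: granularW Id (granular_above I f_sign).
apply: granular_walsh => J; rewrite /coef_above; case: ifP => _.
  exact: rounded_coef_int.
by rewrite mulr0 rpred0.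
Qed.

(** Each error is controlled by the errors strictly above it. *)
Lemma err_le_above I : (#|I| <= d)%N ->
  `|e I| <= 2 ^+ d.+1 * \sum_(J : {set 'I_n} | (I \subset J) && (J != I)) e J ^+ 2.
Proof.
move=> Id; have eI : coef_above I e I = e I by rewrite /coef_above subxx.
have := @granular_coef_le _ _ _ _ I (granular_err_above Id).
rewrite eI => H; apply: le_trans (H _) _.
  by rewrite /coef_err /rounded_coef Id grid_round_dist.
rewrite ler_wpM2l ?exprn_ge0// big_mkcondl; apply: ler_sum => J _.
by rewrite /coef_above; case: ifP; rewrite ?expr0n.
Qed.

(** The sets of size [k + s] above a set of size [k], at most [n ^ s] in number, contribute
    little, since
    [n ^ s * tau ^ (2 (k + s)) = tau ^ k * (ln n) ^ s * tau ^ (k + s)]. *)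
Lemma level_sqr_le I s (C : R) : (s < d)%N ->
  \sum_(J : {set 'I_n} | (I \subset J) && (#|J| == #|I| + s.+1)%N)
     (C * alpha * t ^+ (#|I| + s.+1)) ^+ 2
  <= (log_const d)%:R * C ^+ 2 * alpha * t ^+ #|I|.
Proof.
move=> sd; rewrite sumr_const -[leLHS]mulr_natl.
set k := #|I|; set q := C * alpha * t ^+ _.
apply: (@le_trans _ _ (n%:R ^+ s.+1 * q ^+ 2)).
  rewrite ler_wpM2r ?sqr_ge0// -natrX ler_nat.
  by apply: leq_trans (card_above I s.+1); rewrite cardsE.
have -> : n%:R ^+ s.+1 * q ^+ 2 =
    C ^+ 2 * alpha * t ^+ k * ((alpha * t ^+ (k + s)) * (L ^+ s.+1 * t)).
  rewrite /q -(mul_tau R n_gt1); move: (tau R n) => T.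
  rewrite addnS [T ^+ (k + s).+1]exprSr [(n%:R * T) ^+ _]exprMn.
  by rewrite [T ^+ s.+1]exprSr exprD; ring.
rewrite [leRHS](_ : _ = C ^+ 2 * alpha * t ^+ k * (log_const d)%:R); last by ring.
have t0 := ltW t_gt0; have al0 := ltW alpha_gt0.
apply: ler_wpM2l.
  by apply: mulr_ge0 (exprn_ge0 _ t0); apply: mulr_ge0 al0; exact: sqr_ge0.
have sd' : (s.+1 <= d.+1)%N by exact: ltnW.
apply: le_trans (ln_pow_tau_le R n_gt1 sd').
rewrite -[leRHS]mul1r; apply: ler_wpM2r.
  by apply: mulr_ge0 t0; apply: exprn_ge0; exact: ltW.
by apply: mulr_ile1 => //; [exact: exprn_ge0 | exact: exprn_ile1].
Qed.

Lemma err_above_le C I : (#|I| <= d)%N ->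
  (forall J, I \proper J -> (#|J| <= d)%N -> `|e J| <= C * alpha * t ^+ #|J|) ->
  \sum_(J : {set 'I_n} | (I \subset J) && (J != I)) e J ^+ 2
  <= above_const d C * alpha * t ^+ #|I|.
Proof.
move=> Id eC; rewrite (bigID (fun J : {set 'I_n} => (d < #|J|)%N))/=.
rewrite /above_const !mulrDl; apply: lerD.
  apply: le_trans (tail_weight_le d_gt0 dn f_sign alpha_gt0 alpha_le1 infl Id).
  rewrite [leLHS]big_mkcond [leRHS]big_mkcond/=; apply: ler_sum => J _.
  case: (I \subset J) => //=; case: ltnP => dJ; last by rewrite andbF.
  rewrite andbT; case: ifP => _; last exact: sqr_ge0.
  by rewrite /coef_err /rounded_coef leqNgt dJ subr0.
pose w (s : nat) := (C * alpha * t ^+ (#|I| + s.+1)) ^+ 2.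
apply: (@le_trans _ _ (\sum_(J : {set 'I_n}) \sum_(s < d |
    (I \subset J) && (#|J| == #|I| + s.+1)%N) w s)).
  rewrite big_mkcond; apply: ler_sum => J _.
  have w0 (s : nat) : 0 <= w s by exact: sqr_ge0.
  case: ifP => [/andP[/andP[IJ JI]]|_]; last by apply: sumr_ge0.
  rewrite -leqNgt => dJ; have Jd : (#|J| <= d)%N by [].
  have pIJ : I \proper J by rewrite properEneq eq_sym JI.
  have cIJ : (#|I| < #|J|)%N by exact: proper_card.
  have sd : (#|J| - #|I|.+1 < d)%N by lia.
  have cJ : #|J| = (#|I| + (#|J| - #|I|.+1).+1)%N by lia.
  rewrite (bigD1 (Ordinal sd))/=; last by rewrite IJ -cJ eqxx.
  rewrite -[leLHS]addr0; apply: lerD; last by apply: sumr_ge0.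
  rewrite /w -cJ -[e J ^+ 2]real_normK ?num_real//.
  have H := eC _ pIJ Jd; apply: lerXn2r => //; rewrite nnegrE//.
  exact: le_trans (normr_ge0 _) H.
rewrite (exchange_big_dep predT)//=.
apply: (@le_trans _ _ (\sum_(s < d) (log_const d)%:R * C ^+ 2 * alpha * t ^+ #|I|)).
  apply: ler_sum => s _; exact: level_sqr_le.
by rewrite sumr_const card_ord -[leLHS]mulr_natl natrM !mulrA.
Qed.

Lemma err_le j I : (#|I| <= d)%N -> (d < #|I| + j)%N ->
  `|e I| <= err_const R d j * alpha * t ^+ #|I|.
Proof.
elim: j I => [|j IH] I Id dj; first by rewrite addn0 ltnNge Id in dj.
have T0 : 0 <= alpha * t ^+ #|I|.
  by apply: mulr_ge0 (ltW alpha_gt0) _; apply: exprn_ge0; exact: ltW.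
have IJ J : I \proper J -> (#|J| <= d)%N -> `|e J| <= err_const R d j * alpha * t ^+ #|J|.
  move=> IJ Jd; have cIJ : (#|I| < #|J|)%N by exact: proper_card.
  by apply: IH => //; lia.
have := le_trans (err_le_above Id) (ler_wpM2l (exprn_ge0 d.+1 (ler0n _ 2))
  (err_above_le Id IJ)).
move=> /le_trans; apply.
set A := above_const _ _; set T := t ^+ _.
rewrite [leLHS](_ : _ = (2 ^+ d.+1 * A) * (alpha * T)); last by ring.
rewrite -[leRHS]mulrA; apply: ler_wpM2r => //.
by rewrite /= -/A lerDl err_const_ge0.
Qed.

Lemma dist_le :
  expectation (fun x => (f x - walsh b x) ^+ 2) <= dist_const R d * alpha.
Proof.
have -> : expectation (fun x => (f x - walsh b x) ^+ 2) = \sum_J e J ^+ 2.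
  rewrite -parseval; apply: expectation_ext => x; congr (_ ^+ 2).
  by rewrite (fourier_inversion f) /walsh -sumrB; apply: eq_bigr => J _; rewrite -mulrBl.
have le0 : (#|set0 : {set 'I_n}| <= d)%N by rewrite cards0.
have eC J : (#|J| <= d)%N -> `|e J| <= err_const R d d.+1 * alpha * t ^+ #|J|.
  by move=> Jd; apply: err_le => //; rewrite addnS ltnS leq_addl.
have := @err_above_le (err_const R d d.+1) _ le0 (fun J _ => eC J).
rewrite cards0 expr0 mulr1 => H.
rewrite (bigD1 set0)//= addrC /dist_const mulrDl; apply: lerD.
  apply: le_trans H; rewrite le_eqVlt; apply/orP; left; apply/eqP.
  by apply: eq_bigl => J; rewrite sub0set.
have := eC _ le0; rewrite cards0 expr0 mulr1 => H0.
rewrite -[e set0 ^+ 2]real_normK ?num_real//.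
apply: (@le_trans _ _ ((err_const R d d.+1 * alpha) ^+ 2)).
  apply: lerXn2r => //; rewrite nnegrE//; exact: le_trans (normr_ge0 _) H0.
rewrite exprMn; apply: ler_wpM2l; first exact: sqr_ge0.
by rewrite expr2 ler_piMr// ltW.
Qed.

Lemma granular_diff : granular d (fun x => f x - walsh b x).
Proof.
apply: granularB => [x|]; last by apply: granular_walsh => J; exact: rounded_coef_int.
apply: rpredM; first by rewrite rpredX// natr_int.
by case: (f_sign x) => ->; rewrite ?rpredN rpred1.
Qed.

End Rounding.

(** * The rounded function takes the values -1 and 1 *)

Section SquareMinusOne.
Variables (R : realType) (n : nat).
Implicit Types (I J K : {set 'I_n}) (c : {set 'I_n} -> R).

(** If [walsh c] has degree at most [d] then [walsh c ^ 2 - 1] has degree at most [2 d]. *)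
Lemma fourier_sqr_sub1 c d J : (forall K, (d < #|K|)%N -> c K = 0) ->
  (d + d < #|J|)%N -> fourier (fun x => walsh c x ^+ 2 - 1) J = 0.
Proof.
move=> cd dJ; rewrite /fourier (@expectation_ext _ _ _ (fun x =>
   (\sum_I \sum_K (c I * c K) * (chi R (symdiff I K) x * chi R J x))
   + -1 * chi R J x)); last first.
  move=> x; rewrite mulrBl mul1r mulN1r; congr (_ - _).
  rewrite expr2 /walsh !mulr_suml; apply: eq_bigr => I _.
  rewrite mulr_sumr mulr_suml; apply: eq_bigr => K _; rewrite -chiM; ring.
rewrite expectationD expectationZ expectation_chi.
have -> : (J == set0) = false by apply/eqP => J0; rewrite J0 cards0 in dJ.
rewrite mulr0 addr0 expectation_sum big1// => I _.
rewrite expectation_sum big1// => K _; rewrite expectationZ expectation_chiM.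
have [IKJ|_] := eqVneq (symdiff I K) J; last by rewrite mulr0.
have : (d < #|I|)%N || (d < #|K|)%N.
  by have := card_symdiff I K; rewrite IKJ; lia.
by case/orP => /cd ->; rewrite ?mul0r ?mulr0 ?mul0r.
Qed.

End SquareMinusOne.

Theorem theorem1p7 (R : realType) (d : nat) (hd : (1 <= d)%N) :
  exists C3 C4 : R, 0 < C3 /\ 0 < C4 /\
    forall (n : nat), (d < n)%N ->
    forall (f : cube n -> R), sign_valued f ->
    forall (alpha : R), 0 < alpha -> alpha < C3 ->
    (forall I : {set 'I_n}, #|I| = d.+1 ->
       T_influence I f <= alpha * (ln n%:R / n%:R) ^+ d.+1) ->
    exists g : cube n -> R,
      sign_valued g /\ degree_le d g /\
      forall J : {set 'I_n}, (#|J| <= d)%N ->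
        `| fourier f J - fourier g J |
          <= C4 * alpha * (ln n%:R / n%:R) ^+ #|J|.
Proof.
set D := dist_const R d; set q : R := 9 ^+ (d + d) * 4 ^+ d.
have D0 : 0 <= D by exact: dist_const_ge0.
have q0 : 0 <= q by rewrite mulr_ge0// exprn_ge0.
have qD0 : 0 <= q * D by exact: mulr_ge0.
exists (1 + q * D)^-1, (err_const R d d.+1 + 1).
have C0 := err_const_ge0 R d d.+1.
split; first by rewrite invr_gt0; lra.
split; first by lra.
move=> n dn f fs alpha a0 aC infl.
have qDa : q * D * alpha < 1.
  move: aC; rewrite -[_^-1]mul1r ltr_pdivlMr; last by lra.
  by rewrite mulrC mulrDl mul1r; lra.
have a1 : alpha <= 1.
  apply: le_trans (ltW aC) _; rewrite invf_le1; lra.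
exists (walsh (rounded_coef d f)); split; last first.
  have rd (J : {set 'I_n}) : (d < #|J|)%N -> rounded_coef d f J = 0.
    by rewrite ltnNge /rounded_coef => /negbTE ->.
  split=> [J dJ|J Jd]; rewrite fourier_walsh; first exact: rd.
  have dJ : (d < #|J| + d.+1)%N by rewrite addnS ltnS leq_addl.
  apply: le_trans (err_le hd dn fs a0 a1 infl Jd dJ) _.
  have t0 := tau_gt0 R (leq_ltn_trans hd dn).
  rewrite -!mulrA; apply: ler_wpM2r; last by rewrite lerDl.
  by apply: mulr_ge0 (ltW a0) _; apply: exprn_ge0; exact: ltW.
move=> x0; set b := rounded_coef d f.
have cd (K : {set 'I_n}) : (d < #|K|)%N -> b K = 0.
  by rewrite ltnNge /b /rounded_coef => /negbTE ->.
pose p x := walsh b x ^+ 2 - 1.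
have [px0|px0] := eqVneq (p x0) 0.
  have /eqP : walsh b x0 ^+ 2 = 1 by apply/eqP; rewrite -subr_eq0; apply/eqP.
  by rewrite sqrf_eq1 => /orP[]/eqP ->; [right|left].
(* Now p is not identically zero, and it vanishes wherever walsh b agrees with f. *)
have pd (J : {set 'I_n}) : (d + d < #|J|)%N -> fourier p J = 0 by exact: fourier_sqr_sub1.
rewrite fourier_inversion in px0.
have := low_degree_prob_neq0 pd px0.
have : prob_neq0 (walsh (fourier p)) <= 4 ^+ d * (D * alpha).
  have := granular_prob_neq0 (granular_diff d fs).
  move=> /le_trans /(_ (ler_wpM2l _ (dist_le hd dn fs a0 a1 infl))) => /(_ (exprn_ge0 _ _)) H.
  apply: le_trans (H _) => //; apply: le_expectation => x.
  rewrite -fourier_inversion ler_nat /p -/b.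
  have [fb|_] := eqVneq (f x - walsh b x) 0; last by case: (_ == 0).
  have -> : walsh b x = f x by apply/esym/eqP; rewrite -subr_eq0 fb.
  by case: (fs x) => ->; rewrite ?sqrrN expr1n subrr eqxx.
move=> H1 H2; have : 9 ^+ (d + d) * prob_neq0 (walsh (fourier p)) <= q * D * alpha.
  rewrite /q -!mulrA; apply: ler_wpM2l H1; exact: exprn_ge0.
move=> H3; have := lt_le_trans qDa (le_trans H2 H3); by rewrite ltxx.
Qed.
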